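(* A class $\mathcal{F}$ of graphs is nice if and only if it is closed under taking minors and there is some $k$ such that the complete bipartite graph $K_{3,k}$ does not belong to $\mathcal{F}$.
   Context: Graphs are finite, simple and loopless. For $U,W\subseteq V(G)$, $e(U,W)$ is the number of edges $uw$ of $G$ with $u\in U$, $w\in W$ (edges with both ends in $U\cap W$ counted twice). A family $\mathcal{F}$ of graphs is nice if it is closed under taking minors and there is a constant $\beta_{\mathcal{F}}$ such that for every $G\in\mathcal{F}$ and every $B\subseteq V(G)$, the set $A$ of vertices of $V(G)\setminus B$ having at least three neighbours in $B$ satisfies $e(A,B)\le\beta_{\mathcal{F}}|B|$. *)

(* Defs.v *)
From HB Require Import structures.
From mathcomp Require Import all_boot all_order all_algebra.
From mathcomp Require Import reals.

Set Implicit Arguments.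
Unset Strict Implicit.
Unset Printing Implicit Defensive.

Import Order.TTheory GRing.Theory Num.Theory.

Record sgraph := SGraph {
  vertex :> finType;
  adj : rel vertex;
  adj_sym : symmetric adj;
  adj_irrefl : irreflexive adj
}.

(* Ordered pairs, so an edge with both ends in U :&: W is counted twice. *)
Definition edges_between (G : sgraph) (U W : {set G}) : nat :=
  #|[set p : G * G | [&& p.1 \in U, p.2 \in W & adj p.1 p.2]]|.

Definition neighbours_in (G : sgraph) (B : {set G}) (v : G) : {set G} :=
  [set w in B | adj v w].

Definition induced_rel (G : sgraph) (S : {set G}) : rel G :=
  [rel u v | [&& u \in S, v \in S & adj u v]].

Definition connected_set (G : sgraph) (S : {set G}) : Prop :=
  S != set0 /\ {in S &, forall u v, connect (induced_rel S) u v}.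

(* The sets phi x are the branch sets of a model of H in G: contracting each
   of them, and deleting the remaining vertices and the superfluous edges,
   turns G into a graph isomorphic to H. *)
Definition minor (H G : sgraph) : Prop :=
  exists phi : H -> {set G},
    [/\ forall x, connected_set (phi x),
        forall x y, x != y -> [disjoint phi x & phi y] &
        forall x y, adj x y ->
          exists u v, [/\ u \in phi x, v \in phi y & adj u v]].

Definition minor_closed (F : sgraph -> Prop) : Prop :=
  forall G H, F G -> minor H G -> F H.

Definition nice (R : realType) (F : sgraph -> Prop) : Prop :=
  minor_closed F /\
  exists beta : R, forall G : sgraph, F G -> forall B : {set G},
    let A := [set v in ~: B | 3 <= #|neighbours_in B v|] in
    ((edges_between A B)%:R <= beta * #|B|%:R)%R.

Section CompleteBipartite.
Variables m n : nat.

Definition cb_adj : rel ('I_m + 'I_n) := fun x y =>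
  match x, y with
  | inl _, inr _ | inr _, inl _ => true
  | _, _ => false
  end.

Fact cb_adj_sym : symmetric cb_adj. Proof. by case=> ? [] ?. Qed.
Fact cb_adj_irrefl : irreflexive cb_adj. Proof. by case. Qed.

Definition complete_bipartite : sgraph := SGraph cb_adj_sym cb_adj_irrefl.
End CompleteBipartite.

(* Main.v *)
(** If [G] has no [K_(3,k)] minor then neither [G] nor any minor of it has a
    [K_(k+3)] minor, so by Mader's argument all of them have linearly many
    edges.  Contract vertices of [A] into neighbours in [B], as long as each
    contraction creates a new edge inside [B].  The contracted vertices are then
    at most as many as the edges of the resulting minor on [B], which is
    [O(|B|)].  The neighbourhood in [B] of every other vertex of [A] has become
    a clique; this minor being degenerate, it has [O(|B|)] triangles, and each
    of them lies in the neighbourhood of fewer than [k] vertices of [A].  Hence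
    [|A| = O(|B|)], and [e(A,B) = O(|A| + |B|)]. *)

Require Import Defs.
From mathcomp Require Import all_boot all_order all_algebra.
From mathcomp Require Import reals.
From mathcomp Require Import zify.

Set Implicit Arguments.
Unset Strict Implicit.
Unset Printing Implicit Defensive.

(** * Connected vertex sets *)

Section Connected.
Variable G : sgraph.
Implicit Types (S T : {set G}) (u v : G).

Lemma connect_induced_sym S : connect_sym (induced_rel S).
Proof.
apply: sym_connect_sym => u v.
by rewrite /induced_rel /= adj_sym andbCA.
Qed.

Lemma connect_induced_sub S T u v :
  S \subset T -> connect (induced_rel S) u v -> connect (induced_rel T) u v.
Proof.
move=> /subsetP sST; apply: connect_sub => x y /and3P[xS yS xy].
by apply: connect1; rewrite /induced_rel /= !sST.
Qed.

Lemma connected_set1 v : connected_set [set v].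
Proof.
split; first by apply/set0Pn; exists v; rewrite inE.
by move=> x y /set1P-> /set1P->.
Qed.

(** Fibres of the contractions below have this shape: a centre together with the neighbours
    contracted into it. *)
Lemma connected_star S u :
  u \in S -> {in S, forall x, x = u \/ adj x u} -> connected_set S.
Proof.
move=> uS star; split; first by apply/set0Pn; exists u.
have toU x : x \in S -> connect (induced_rel S) x u.
  move=> xS; case: (star x xS) => [->//|xu].
  by apply: connect1; rewrite /induced_rel /= xS uS.
move=> x y xS yS; apply: connect_trans (toU x xS) _.
by rewrite connect_induced_sym toU.
Qed.

End Connected.

(** * Quotients of a graph by a map on its vertices *)

Section Quotient.
Variables (G : sgraph) (s : G -> G).

Definition quotient_adj : rel G := fun x y =>
  (x != y) && [exists u, exists v, [&& s u == x, s v == y & adj u v]].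

Fact quotient_adj_sym : symmetric quotient_adj.
Proof.
suff sub x y : quotient_adj x y -> quotient_adj y x.
  by move=> x y; apply/idP/idP; apply: sub.
case/andP=> xy /existsP[u /existsP[v /and3P[ux vy uv]]].
rewrite /quotient_adj eq_sym xy; apply/existsP; exists v; apply/existsP.
by exists u; rewrite ux vy adj_sym.
Qed.

Fact quotient_adj_irrefl : irreflexive quotient_adj.
Proof. by move=> x; rewrite /quotient_adj eqxx. Qed.

(* The quotient keeps the vertex type of G: vertices outside the image of s
   stay as isolated ones. *)
Definition quotient_graph : sgraph :=
  SGraph quotient_adj_sym quotient_adj_irrefl.

Lemma quotient_adjP (x y : G) :
  reflect (x != y /\ exists u v, [/\ s u = x, s v = y & adj u v])
          (@adj quotient_graph x y).
Proof.
apply: (iffP andP) => [[xy ex]|[xy [u [v [ux vy uv]]]]]; split=> //.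
  case/existsP: ex => u /existsP[v /and3P[/eqP ux /eqP vy uv]].
  by exists u, v.
by apply/existsP; exists u; apply/existsP; exists v; rewrite ux vy !eqxx.
Qed.

(** A path of the quotient lifts: each of its edges comes from an edge of [G] between two fibres,
    and the connected fibres join the ends of successive lifted edges. *)
Lemma connected_preim (T : {set G}) :
  {in T, forall x, connected_set (s @^-1: [set x])} ->
  @connected_set quotient_graph T -> connected_set (s @^-1: T).
Proof.
move=> fib [/set0Pn[x0 x0T] conT]; split.
  have [/set0Pn[u]] := fib x0 x0T; rewrite !inE => /eqP ux _.
  by apply/set0Pn; exists u; rewrite inE ux.
have same u v : s u \in T -> s u = s v ->
    connect (induced_rel (s @^-1: T)) u v.
  move=> uT uv; have [_ cf] := fib _ uT.
  have: connect (induced_rel (s @^-1: [set s u])) u v.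
    by apply: cf; rewrite !inE // uv.
  by apply: connect_induced_sub; apply/subsetP=> w; rewrite !inE => /eqP->.
move=> u v; rewrite !inE => uT vT.
have /connectP[p] := conT _ _ uT vT.
elim: p u uT => [|y p IHp] u uT /=; first by move=> _ /esym; apply: same.
case/andP=> /and3P[_ yT /quotient_adjP[_ [a [b [au by_ ab]]]]] pth lst.
apply: (@connect_trans _ _ a); first exact: same.
apply: (@connect_trans _ _ b).
  by apply: connect1; rewrite /induced_rel /= !inE au by_ uT yT.
by apply: IHp; rewrite ?by_.
Qed.

End Quotient.

(** * Complete minors inside a vertex set *)

(** A model of [K_t] with its branch sets confined to [S]. Indexing by [nat] lets a further branch
    set be prepended by a shift. *)
Definition clique_model (G : sgraph) (S : {set G}) (t : nat) : Prop :=
  exists phi : nat -> {set G},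
    [/\ forall i, i < t -> phi i \subset S,
        forall i, i < t -> connected_set (phi i),
        forall i j, i < t -> j < t -> i != j -> [disjoint phi i & phi j] &
        forall i j, i < t -> j < t -> i != j ->
          exists u v, [/\ u \in phi i, v \in phi j & adj u v]].

(** Branch sets are pulled back along [s]. This takes the place of transitivity of the minor
    relation. *)
Lemma clique_model_quotient (G : sgraph) (s : G -> G) (S : {set G}) t :
  {in S, forall x, connected_set (s @^-1: [set x])} ->
  @clique_model (quotient_graph s) S t -> clique_model (s @^-1: S) t.
Proof.
move=> fib [phi [sub con dis edg]]; exists (fun i => s @^-1: phi i); split.
- by move=> i it; apply: preimsetS; apply: sub.
- move=> i it; apply: connected_preim; last exact: con.
  by move=> x xi; apply: fib; apply: (subsetP (sub i it)).
- move=> i j it jt ij; have := dis i j it jt ij.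
  rewrite -!setI_eq0 => /eqP d; apply/eqP/setP=> x; rewrite !inE.
  by have /setP/(_ (s x)) := d; rewrite !inE.
- move=> i j it jt ij; have [x [y [xi yj]]] := edg i j it jt ij.
  case/quotient_adjP=> _ [u [v [ux vy uv]]].
  by exists u, v; rewrite !inE ux vy.
Qed.

(** The singleton of [v] is the new branch set: it is adjacent to all the others, as they lie in its
    neighbourhood. *)
Lemma clique_model_cone (G : sgraph) (S : {set G}) (v : G) t :
  v \in S -> clique_model (neighbours_in S v) t -> clique_model S t.+1.
Proof.
move=> vS [phi [sub con dis edg]].
have Nadj i x : i < t -> x \in phi i -> x \in S /\ adj v x.
  by move=> it /(subsetP (sub i it)); rewrite inE => /andP.
have vN i : i < t -> v \notin phi i.
  by move=> it; apply/negP => /(Nadj _ _ it)[_]; rewrite adj_irrefl.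
have ne i : i < t -> exists x, x \in phi i.
  by move=> it; have [/set0Pn] := con i it.
exists (fun i => if i is j.+1 then phi j else [set v]); split.
- case=> [_|i it]; first by rewrite sub1set.
  by apply/subsetP=> x /(Nadj _ _ it)[].
- by case=> [_|i it]; [exact: connected_set1 | exact: con].
- case=> [|i] [|j] // it jt ij.
  + by rewrite disjoints1 vN.
  + by rewrite disjoint_sym disjoints1 vN.
  + exact: dis.
- case=> [|i] [|j] // it jt ij.
  + have [x xj] := ne j jt; have [_ vx] := Nadj _ _ jt xj.
    by exists v, x; rewrite inE.
  + have [x xi] := ne i it; have [_ vx] := Nadj _ _ it xi.
    by exists x, v; rewrite inE adj_sym.
  + exact: edg.
Qed.

Lemma edges_between_sum (G : sgraph) (U W : {set G}) :
  edges_between U W = \sum_(u in U) #|neighbours_in W u|.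
Proof.
rewrite /edges_between -sum1dep_card.
rewrite (eq_bigl (fun p => (p.1 \in U) && ((p.2 \in W) && adj p.1 p.2))) //.
rewrite -(pair_big_dep (mem U) (fun u w => (w \in W) && adj u w)
           (fun _ _ => 1)).
by apply: eq_bigr => u _; rewrite sum1dep_card.
Qed.

(** * Contraction of a single edge *)

Section Contraction.
Variables (G : sgraph) (S : {set G}) (u v : G).
Hypotheses (uS : u \in S) (vS : v \in S) (uv : adj u v).

Definition merge (x : G) : G := if x == v then u else x.

Let neq_uv : u != v.
Proof. by apply: contraTneq uv => ->; rewrite adj_irrefl. Qed.

(** Contracting [uv] destroys this edge and identifies [vx] with [ux] for each common neighbour [x].
    Edges are counted in both orders, hence the doubling and the [2]. *)
Lemma edges_between_contract :
  edges_between S S <=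
    @edges_between (quotient_graph merge) (S :\ v) (S :\ v)
    + (#|neighbours_in (neighbours_in S u) v|.*2 + 2).
Proof.
set C := neighbours_in _ v.
pose E := [set p : G * G | [&& p.1 \in S, p.2 \in S & adj p.1 p.2]].
(* The ordered edges to discard: on the remaining ones the map [g] below is injective. *)
pose D := ([set (u, v); (v, u)] :|: [set (v, x) | x in C])
          :|: [set (x, v) | x in C].
have cardD : #|D| <= #|C|.*2 + 2.
  apply: leq_trans (leq_card_setU _ _) _.
  have h1 : #|[set (v, x) | x in C]| <= #|C| by exact: leq_imset_card.
  have h2 : #|[set (x, v) | x in C]| <= #|C| by exact: leq_imset_card.
  have [h3 _] := leq_card_setU [set (u, v); (v, u)] [set (v, x) | x in C].
  have h4 : #|[set (u, v); (v, u)]| <= 2 by rewrite cards2; case: (_ != _).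
  lia.
have cE : edges_between S S <= #|E :\: D| + #|D|.
  rewrite /edges_between -/E -(cardsID D E) addnC leq_add2l.
  by apply: subset_leq_card; apply: subsetIr.
apply: leq_trans cE _; apply: leq_add => //.
pose g (p : G * G) := (merge p.1, merge p.2).
have inD1 x : x \in S -> adj u x -> adj v x -> (v, x) \in D.
  move=> xS ux vx; rewrite !inE; apply/orP; left; apply/orP; right.
  by apply/imsetP; exists x; rewrite // !inE xS ux vx.
have inD2 x : x \in S -> adj u x -> adj v x -> (x, v) \in D.
  move=> xS ux vx; rewrite !inE; apply/orP; right.
  by apply/imsetP; exists x; rewrite // !inE xS ux vx.
have Duv : (u, v) \in D by rewrite !inE eqxx.
have Dvu : (v, u) \in D by rewrite !inE eqxx orbT.
have mergeP x y : merge x = merge y ->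
    [\/ x = y, x = u /\ y = v | x = v /\ y = u].
  rewrite /merge; case: eqP => [->|_]; case: eqP => [->|_].
  - by constructor 1.
  - by move=> <-; constructor 3.
  - by move=> ->; constructor 2.
  - by constructor 1.
have injg : {in E :\: D &, injective g}.
  move=> [x y] [x' y'] /setDP[+ nD] /setDP[+ nD']; rewrite !inE /=.
  move=> /and3P[xS yS xy] /and3P[xS' yS' xy'] [/mergeP hx /mergeP hy].
  case: hx => [ex|[ex ex']|[ex ex']]; case: hy => [ey|[ey ey']|[ey ey']];
    subst => //.
  - by move: nD'; rewrite inD2 // adj_sym.
  - by move: nD; rewrite inD2 // adj_sym.
  - by move: nD'; rewrite inD1.
  - by rewrite adj_irrefl in xy.
  - by rewrite Duv in nD.
  - by move: nD; rewrite inD1.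
  - by rewrite Dvu in nD.
  - by rewrite adj_irrefl in xy.
rewrite -(card_in_imset injg); apply: subset_leq_card.
apply/subsetP=> q /imsetP[[x y] /setDP[+ nD] ->{q}].
rewrite inE /= => /and3P[xS yS xy].
have mS z : z \in S -> merge z \in S :\ v.
  by move=> zS; rewrite /merge !inE; case: ifP => [_|->]; rewrite ?neq_uv.
rewrite inE /= !mS //=; apply/quotient_adjP; split; last by exists x, y.
apply/eqP=> /mergeP[e|[e1 e2]|[e1 e2]]; subst.
- by rewrite adj_irrefl in xy.
- by rewrite Duv in nD.
- by rewrite Dvu in nD.
Qed.

(** Over [S :\ v] the fibre of [u] is the edge [uv] and every other fibre is a singleton, so models
    pull back. *)
Lemma clique_model_contract t :
  @clique_model (quotient_graph merge) (S :\ v) t -> clique_model S t.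
Proof.
have eS : merge @^-1: (S :\ v) = S.
  apply/setP=> x; rewrite !inE /merge; have [->|xv] := eqVneq x v.
    by rewrite neq_uv uS vS.
  by rewrite xv.
move=> cm; rewrite -eS; apply: clique_model_quotient cm.
move=> x; rewrite !inE => /andP[xv xS].
apply: (@connected_star _ _ x); first by rewrite !inE /merge (negPf xv).
move=> y; rewrite !inE /merge.
have [-> /eqP <-|_ /eqP] := eqVneq y v; last by left.
by right; rewrite adj_sym.
Qed.

End Contraction.

(** * Density forces complete minors *)

Lemma edges_between_gt0 (G : sgraph) (U W : {set G}) :
  0 < edges_between U W -> exists u v, [/\ u \in U, v \in W & adj u v].
Proof.
by case/card_gt0P=> -[u v]; rewrite inE => /and3P[? ? ?]; exists u, v.
Qed.

(* Mader's argument: contract an edge with few common neighbours, or find a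
   dense neighbourhood. *)
Lemma clique_model_dense t (G : sgraph) (S : {set G}) :
  0 < #|S| -> 2 ^ t * #|S| <= edges_between S S -> clique_model S t.
Proof.
elim: t G S => [|t IHt] G S; first by exists (fun _ => set0).
have [n] := ubnP #|S|; elim: n G S => // n IHn G S lt_Sn S0 dense.
have [/existsP[u /existsP[v /and4P[uS vS uv sparse]]]|] :=
  boolP [exists u : G, exists v : G, [&& u \in S, v \in S, adj u v
    & #|neighbours_in (neighbours_in S u) v|.*2 + 2 <= 2 ^ t.+1]].
  apply: (clique_model_contract uS vS uv); have := cardsD1 v S; rewrite vS.
  have u' : u \in S :\ v.
    by rewrite !inE uS andbT; apply: contraTneq uv => ->; rewrite adj_irrefl.
  have pos : 0 < #|S :\ v| by apply/card_gt0P; exists u.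
  have := edges_between_contract uS vS uv => h cS.
  apply: IHn => //; first by rewrite cS in lt_Sn.
  (* Losing one vertex lowers the required count by [2 ^ t.+1], which is at least the number of
     ordered edges lost. *)
  rewrite cS mulnDr muln1 in dense; rewrite -(leq_add2l (2 ^ t.+1)).
  apply: leq_trans dense _; apply: leq_trans h _.
  by rewrite addnC leq_add2r.
rewrite negb_exists => /forallP no.
have common u v : u \in S -> v \in S -> adj u v ->
    2 ^ t <= #|neighbours_in (neighbours_in S u) v|.
  move=> uS vS uv; have := no u; rewrite negb_exists => /forallP/(_ v).
  by rewrite uS vS uv /= -ltnNge expnS; lia.
have [u [v [uS vS uv]]] : exists u v, [/\ u \in S, v \in S & adj u v].
  apply: edges_between_gt0; apply: leq_trans dense.
  by rewrite muln_gt0 expn_gt0.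
(* All degrees inside the neighbourhood of [u] are at least [2 ^ t], so induction finds a model of
   [K_t] there, and [u] extends it. *)
apply: (clique_model_cone uS); apply: IHt.
  by apply/card_gt0P; exists v; rewrite inE vS.
rewrite edges_between_sum mulnC -sum_nat_const; apply: leq_sum => w.
by rewrite inE => /andP[wS uw]; apply: common.
Qed.

(** * Two sources of [K_(3,k)] minors *)

(** [K_(3,k)] is a spanning subgraph of [K_(3+k)]; [idx] numbers its vertices. *)
Lemma clique_model_minor (G : sgraph) (S : {set G}) k :
  clique_model S (3 + k) -> minor (complete_bipartite 3 k) G.
Proof.
case=> phi [_ con dis edg].
pose idx (x : 'I_3 + 'I_k) : nat :=
  match x with inl i => i | inr j => 3 + j end.
have ltx x : idx x < 3 + k.
  by case: x => i /=; have := ltn_ord i; lia.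
have inj x y : idx x = idx y -> x = y.
  case: x => [i|i]; case: y => [j|j] //= e.
  - by congr inl; apply: val_inj.
  - by have := ltn_ord i; lia.
  - by have := ltn_ord j; lia.
  - by congr inr; apply: val_inj => /=; lia.
exists (fun x => phi (idx x)); split=> [x|x y xy|x y xy].
- exact: con.
- by apply: dis => //; apply: contra xy => /eqP/inj ->.
- apply: edg => //; apply/eqP=> /inj e.
  by move: xy; rewrite e adj_irrefl.
Qed.

Lemma common_neighbours_minor (G : sgraph) (x y z : G) (W : {set G}) k :
  x != y -> x != z -> y != z -> k <= #|W| ->
  {in W, forall w, [/\ adj w x, adj w y & adj w z]} ->
  minor (complete_bipartite 3 k) G.
Proof.
move=> xy xz yz kW adjW.
pose f (i : 'I_3) := nth x [:: x; y; z] i.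
have injf : injective f.
  move=> i j /eqP; rewrite nth_uniq //; first by move/eqP/val_inj.
  by rewrite /= !inE negb_or xy xz yz.
pose g (j : 'I_k) := enum_val (widen_ord kW j).
have gW j : g j \in W by apply: enum_valP.
have injg : injective g.
  by move=> i j /enum_val_inj/(congr1 val) /= /val_inj.
have fg i j : adj (f i) (g j).
  have [? ? ?] := adjW _ (gW j); rewrite adj_sym /f.
  by case: i => -[|[|[|]]].
have nfg i j : f i != g j.
  by apply: contraTneq (fg i j) => ->; rewrite adj_irrefl.
exists (fun v => match v with inl i => [set f i] | inr j => [set g j] end).
split.
- by case=> ?; apply: connected_set1.
- case=> i [] j ij; rewrite disjoints1 inE ?nfg //.
  + by apply: contra ij => /eqP/injf->.
  + by rewrite eq_sym nfg.
  + by apply: contra ij => /eqP/injg->.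
- case=> i [] j //= _.
  + by exists (f i), (g j); rewrite !inE.
  + by exists (g i), (f j); rewrite !inE adj_sym.
Qed.

(** * Counting cliques in a degenerate graph *)

Lemma card_bigcup_const (I T : finType) (P : {set I}) (F : I -> {set T}) n :
  {in P, forall i, #|F i| <= n} -> #|\bigcup_(i in P) F i| <= #|P| * n.
Proof.
move=> le_n; rewrite -sum_nat_const.
elim/big_rec2: _ => [|i m A iP le_m]; first by rewrite cards0.
by apply: leq_trans (leq_card_setU _ _) _; apply: leq_add => //; apply: le_n.
Qed.

(* Peel off vertices of small degree: a neighbourhood that drops below three
   elements when v is removed contained a triangle through v. *)
Lemma degenerate_count (T : finType) (h : rel T) (B U : {set T})
    (N : T -> {set T}) (c k : nat) :
  (forall S : {set T}, S \subset B -> S != set0 ->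
     exists2 v, v \in S & #|[set w in S | h v w]| <= c) ->
  {in U, forall a, {in N a &, forall x y, x != y -> h x y}} ->
  (forall x y z, x != y -> x != z -> y != z ->
     #|[set a in U | [&& x \in N a, y \in N a & z \in N a]]| <= k) ->
  forall S : {set T}, S \subset B ->
    #|[set a in U | 3 <= #|N a :&: S|]| <= c ^ 2 * k * #|S|.
Proof.
move=> low clq few S; have [n] := ubnP #|S|; elim: n S => // n IHn S leSn sSB.
have [->|S0] := eqVneq S set0.
  rewrite cards0 muln0 leqn0 cards_eq0; apply/eqP/setP=> a.
  by rewrite !inE setI0 cards0 andbF.
have [v vS dv] := low S sSB S0.
set D := [set w in S | h v w] in dv.
have cS := cardsD1 v S; rewrite vS in cS.
have IH : #|[set a in U | 3 <= #|N a :&: (S :\ v)|]| <= c ^ 2 * k * #|S :\ v|.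
  by apply: IHn; [lia | apply: subset_trans sSB; apply: subsetDl].
pose P := [set p : T * T in setX D D | [&& v != p.1, v != p.2 & p.1 != p.2]].
pose X (p : T * T) := [set a in U | [&& v \in N a, p.1 \in N a & p.2 \in N a]].
have cX : #|\bigcup_(p in P) X p| <= #|P| * k.
  apply: card_bigcup_const => p; rewrite inE => /andP[_ /and3P[]].
  exact: few.
have cP : #|P| <= c ^ 2.
  apply: (@leq_trans #|setX D D|).
    by apply: subset_leq_card; apply/subsetP=> p; rewrite inE => /andP[].
  by rewrite cardsX -mulnn leq_mul.
(* If [a] drops out, [N a] meets [S] in [v] and exactly two other vertices. Being in the clique
   [N a], these two are neighbours of [v], so they form one of the at most [c ^ 2] pairs in [P]. *)
have cover : [set a in U | 3 <= #|N a :&: S|] \subset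
    [set a in U | 3 <= #|N a :&: (S :\ v)|] :|: \bigcup_(p in P) X p.
  apply/subsetP=> a; rewrite !inE => /andP[aU a3]; rewrite aU /=.
  case: leqP => //= lt3.
  have eqI : (N a :&: S) :\ v = N a :&: (S :\ v).
    by apply/setP=> x; rewrite !inE andbCA.
  have := cardsD1 v (N a :&: S); rewrite eqI inE vS andbT.
  case: (boolP (v \in N a)) => [va|_] cI; last by lia.
  have /card_gt1P[x [y []]] : 1 < #|N a :&: (S :\ v)| by lia.
  rewrite !inE => /and3P[xa xv xS] /and3P[ya yv yS] xy.
  apply/bigcupP; exists (x, y); rewrite !inE /= ?aU ?va ?xa ?ya //.
  by rewrite xS yS xy !(eq_sym v) xv yv !(clq a) // eq_sym.
apply: leq_trans (subset_leq_card cover) _.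
apply: leq_trans (leq_card_setU _ _) _.
have := leq_mul cP (leqnn k); rewrite cS; lia.
Qed.

(** * Graphs without a [K_(3,k)] minor *)

Section NoMinor.
Variables (G : sgraph) (k : nat).
Hypothesis noK : ~ minor (complete_bipartite 3 k) G.

(** A dense part of the quotient would contain a model of [K_(3+k)], which pulls back to [G]. *)
Lemma no_minor_sparse (s : G -> G) (S : {set G}) :
  {in S, forall x, connected_set (s @^-1: [set x])} -> S != set0 ->
  @edges_between (quotient_graph s) S S < 2 ^ (3 + k) * #|S|.
Proof.
move=> fib S0; rewrite ltnNge; apply/negP=> dense; apply: noK.
apply: clique_model_minor (clique_model_quotient fib _).
by apply: clique_model_dense; rewrite // card_gt0.
Qed.

Lemma no_minor_edges (S : {set G}) :
  edges_between S S <= 2 ^ (3 + k) * #|S|.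
Proof.
have [S0|S0] := posnP #|S|.
  have -> : S = set0 by apply/eqP; rewrite -cards_eq0 S0.
  by rewrite edges_between_sum big_set0.
rewrite leqNgt; apply/negP=> dense; apply: noK.
by apply: clique_model_minor (clique_model_dense S0 (ltnW dense)).
Qed.

Variable B : {set G}.
Local Notation A := [set v in ~: B | 3 <= #|neighbours_in B v|].
Local Notation c := (2 ^ (3 + k)).

Definition moved (s : {ffun G -> G}) := [set x | s x != x].

(* s sends each contracted vertex to the neighbour it is contracted into and
   fixes every other vertex. *)
Definition contraction (s : {ffun G -> G}) :=
  [forall x, (s x == x) || [&& x \in A, s x \in B & adj x (s x)]].

Lemma contraction_fix s x : contraction s -> x \in B -> s x = x.
Proof.
move=> /forallP/(_ x)/orP[/eqP//|/and3P[]].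
by rewrite !inE => /andP[/negPf->].
Qed.

Lemma contraction_fibre s :
  contraction s -> {in B, forall x, connected_set (s @^-1: [set x])}.
Proof.
move=> cs b bB; apply: (@connected_star _ _ b).
  by rewrite !inE contraction_fix.
move=> x; rewrite !inE => /eqP <-.
by have /forallP/(_ x)/orP[/eqP|/and3P[_ _]] := cs; [left | right].
Qed.

(** Take as many moved vertices as possible while the edges on [B] still pay for them. If an unmoved
    vertex had two neighbours in [B] not adjacent in the quotient, moving it to one of them would
    create the missing edge and contradict maximality. *)
Lemma greedy_contraction : exists s,
  [/\ contraction s,
      #|moved s| <= @edges_between (quotient_graph s) B B &
      {in A :\: moved s, forall a, {in neighbours_in B a &, forall x y,
         x != y -> @adj (quotient_graph s) x y}}].
Proof.
pose ok (s : {ffun G -> G}) :=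
  contraction s && (#|moved s| <= @edges_between (quotient_graph s) B B).
have ok1 : ok [ffun x => x].
  apply/andP; split; first by apply/forallP=> x; rewrite ffunE eqxx.
  rewrite (_ : moved _ = set0) ?cards0 //.
  by apply/setP=> x; rewrite !inE ffunE eqxx.
have [s /andP[cs ms] smax] := @arg_maxnP _ _ ok (fun s => #|moved s|) ok1.
exists s; split=> // a /setDP[aA]; rewrite inE negbK => /eqP sa x y.
rewrite !inE => /andP[xB ax] /andP[yB ay] xy; apply/negPn/negP=> nadj.
have aB : a \notin B by move: aA; rewrite !inE => /andP[].
pose s' := [ffun z => if z == a then x else s z].
have s'E z : z != a -> s' z = s z by move=> /negPf za; rewrite ffunE za.
have s'a : s' a = x by rewrite ffunE eqxx.
have ya : y != a by apply: contraNneq aB => <-.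
have xa : x != a by apply: contraNneq aB => <-.
have cs' : contraction s'.
  apply/forallP=> z; have [->|za] := eqVneq z a.
    by rewrite s'a aA xB ax orbT.
  by rewrite s'E //; apply: (forallP cs).
have ms' : moved s' = a |: moved s.
  apply/setP=> z; rewrite !inE.
  have [->|za] := eqVneq z a; first by rewrite s'a.
  by rewrite s'E.
have cms' : #|moved s'| = #|moved s|.+1.
  by rewrite ms' cardsU1 inE sa eqxx.
have es' : @edges_between (quotient_graph s) B B
           < @edges_between (quotient_graph s') B B.
  apply: proper_card; apply/properP; split.
    (* Old edges survive: [a] is fixed by [s] and outside [B], so it lies in no fibre over [B] and
       witnesses none of them. *)
    apply/subsetP=> -[p q]; rewrite !inE /= => /and3P[pB qB].
    case/quotient_adjP=> pq [u [w [su sw uw]]]; rewrite pB qB /=.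
    apply/quotient_adjP; split=> //; exists u, w; rewrite !s'E //.
      by apply: contraNneq aB => e; rewrite -sa -e sw.
    by apply: contraNneq aB => e; rewrite -sa -e su.
  exists (x, y); rewrite !inE /= xB yB //=.
  apply/quotient_adjP; split=> //; exists a, y; split=> //.
  by rewrite s'E // (contraction_fix cs).
have := smax s'; rewrite /ok cs' cms' (leq_trans _ es') // => /(_ isT).
by rewrite /= ltnn.
Qed.

(** The term [c] pays for the moved vertices, through the sparsity of the quotient on [B]; the term
    [c ^ 2 * k] pays for the others, through [degenerate_count]. *)
Lemma no_minor_card_attached : #|A| <= (c + c ^ 2 * k) * #|B|.
Proof.
have [s [cs ms clq]] := greedy_contraction.
have fib := contraction_fibre cs.
(* The average degree of the quotient on [S] is below [c], so some vertex has degree at most [c]. *)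
have low (S : {set G}) : S \subset B -> S != set0 ->
    exists2 v, v \in S & #|[set w in S | @adj (quotient_graph s) v w]| <= c.
  move=> sSB S0; have fibS : {in S, forall x, connected_set (s @^-1: [set x])}.
    by move=> x /(subsetP sSB); apply: fib.
  have := no_minor_sparse fibS S0; rewrite edges_between_sum => sparse.
  have [/exists_inP[v vS dv]|no] := boolP [exists v in S,
      #|[set w in S | @adj (quotient_graph s) v w]| <= c]; first by exists v.
  exfalso; move: sparse; rewrite ltnNge => /negP; apply.
  rewrite mulnC -sum_nat_const; apply: leq_sum => v vS; apply: ltnW.
  by rewrite ltnNge; apply: contra no => dv; apply/exists_inP; exists v.
(* These neighbourhoods are taken in [G], not in the quotient, so too many common neighbours give a
   [K_(3,k)] in [G] itself. *)
have few x y z : x != y -> x != z -> y != z ->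
    #|[set a in A :\: moved s | [&& x \in neighbours_in B a,
        y \in neighbours_in B a & z \in neighbours_in B a]]| <= k.
  move=> xy xz yz; rewrite leqNgt; apply/negP=> /ltnW big; apply: noK.
  apply: common_neighbours_minor xy xz yz big _ => a; rewrite inE => /andP[_].
  by rewrite !inE => /and3P[/andP[_ ?] /andP[_ ?] /andP[_ ?]].
have := degenerate_count low clq few (subxx B).
have -> : [set a in A :\: moved s | 3 <= #|neighbours_in B a :&: B|]
          = A :\: moved s.
  apply/setP=> a; rewrite inE andb_idr // => /setDP[aA _].
  rewrite (setIidPl _); first by move: aA; rewrite inE => /andP[].
  by apply/subsetP=> w; rewrite inE => /andP[].
have : #|moved s| <= c * #|B|.
  apply: leq_trans ms _; have [B0|B0] := eqVneq B set0.
    by rewrite B0 edges_between_sum big_set0.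
  exact/ltnW/no_minor_sparse.
have := cardsID (moved s) A.
have : #|A :&: moved s| <= #|moved s|.
  by apply: subset_leq_card; apply: subsetIr.
lia.
Qed.

(** The edges counted lie within [A :|: B], which has [O(|B|)] vertices and spans linearly many
    edges. *)
Lemma no_minor_nice : edges_between A B <= c * (c + c ^ 2 * k + 1) * #|B|.
Proof.
apply: (@leq_trans (edges_between (A :|: B) (A :|: B))).
  apply: subset_leq_card; apply/subsetP=> p.
  by rewrite !inE => /and3P[-> -> ->]; rewrite orbT.
apply: leq_trans (no_minor_edges _) _.
rewrite -mulnA leq_mul2l; apply/orP; right.
apply: leq_trans (leq_card_setU _ _) _.
have := no_minor_card_attached; lia.
Qed.

End NoMinor.

(** * Complete bipartite graphs and the equivalence *)

(** With the side of size three as [B], the inequality defining niceness forces [k <= beta]. *)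
Lemma complete_bipartite_edges k :
  let B := [set inl i | i : 'I_3] : {set complete_bipartite 3 k} in
  let A := [set v in ~: B | 3 <= #|neighbours_in B v|] in
  #|B| = 3 /\ 3 * k <= edges_between A B.
Proof.
move=> B A.
have cB : #|B| = 3 by rewrite card_imset ?card_ord //; apply: inl_inj.
split=> //.
have nB j : neighbours_in B (inr j) = B.
  apply/setP=> x; rewrite inE andb_idr //.
  by case/imsetP=> i _ ->.
have jA j : inr j \in A.
  by rewrite !inE nB cB andbT; apply/negP; case/imsetP.
rewrite -[X in X * k]card_ord -[X in _ * X]card_ord -card_prod.
pose g (p : 'I_3 * 'I_k) : complete_bipartite 3 k * complete_bipartite 3 k :=
  (inr p.2, inl p.1).
have injg : injective g by move=> [i j] [i' j'] [-> ->].
rewrite -cardsT -(card_imset _ injg); apply: subset_leq_card.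
apply/subsetP=> _ /imsetP[[i j] _ ->]; rewrite inE /= jA /= andbT.
exact: imset_f.
Qed.

Theorem theorem2p4 (R : realType) (F : sgraph -> Prop) :
  nice R F <->
  minor_closed F /\ exists k : nat, ~ F (complete_bipartite 3 k).
Proof.
split=> [[mc [beta nb]]|[mc [k noK]]]; split=> //; last first.
  pose c := 2 ^ (3 + k).
  exists ((c * (c + c ^ 2 * k + 1))%:R)%R => G FG B /=.
  rewrite -GRing.natrM Num.Theory.ler_nat; apply: no_minor_nice => mK.
  by apply: noK; apply: mc mK.
(* An integer exceeding the absolute value of [beta], so that [3 * k <= beta * 3] is impossible. *)
pose k := Num.bound `|beta|%R.
exists k => FK; have [cB eAB] := complete_bipartite_edges k.
have := nb _ FK [set inl i | i : 'I_3]; rewrite cB => le_beta.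
have: ((3 * k)%:R <= beta * 3%:R)%R.
  by apply: Order.POrderTheory.le_trans le_beta; rewrite Num.Theory.ler_nat.
rewrite mulnC GRing.natrM Num.Theory.ler_pM2r ?Num.Theory.ltr0n //.
rewrite Order.TotalTheory.leNgt => /negP; apply.
apply: Order.POrderTheory.le_lt_trans (Num.Theory.ler_norm _) _.
exact: Num.Theory.archi_boundP.
Qed.
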